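(* Let $K$ be a field, $B = [b_{ij}] \in K^{n\times n}$ and $\vec{v} = [v_1\ \ldots\ v_n]^T \in K^{n\times 1}$. Then for all $1 \le i \le n$ and all $1 \le k < n$, $$\delta_k^i\Big(B; \sum_{j=1}^n b_{1j}v_j, \ldots, \sum_{j=1}^n b_{nj}v_j\Big) + \delta_{k+1}^i\big(B; v_1,\ldots,v_n\big) = \delta_k(B)\, v_i.$$
   Context: For a square matrix $M\in K^{n\times n}$: $\delta_k(M)$ denotes the sum of the principal minors of $M$ of order $k$ ($1\le k\le n$), and $\delta_k^i(M)$ denotes the sum of the principal minors of $M$ of order $k$ containing the $i$th column ($1\le i,k\le n$). For $w_1,\ldots,w_n\in K$, $B^i(w_1,\ldots,w_n)\in K^{n\times n}$ is the matrix obtained from $B$ by substituting $[w_1\ \ldots\ w_n]^T$ in place of the $i$th column, and $\delta_k^i(B; w_1,\ldots,w_n) = \delta_k^i\big(B^i(w_1,\ldots,w_n)\big)$. *)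

(* Defs.v *)
From mathcomp Require Import all_boot all_order all_algebra.

Set Implicit Arguments.
Unset Strict Implicit.
Unset Printing Implicit Defensive.

Import GRing.Theory.
Local Open Scope ring_scope.

(* [enum_val] lists the elements of [S] in increasing order, so this is the
   determinant of the submatrix on the rows and columns indexed by [S]. *)
Definition principal_minor (K : fieldType) (n : nat) (M : 'M[K]_n)
    (S : {set 'I_n}) : K :=
  \det (mxsub (@enum_val _ (mem S)) (@enum_val _ (mem S)) M).

Definition delta (K : fieldType) (n : nat) (k : nat) (M : 'M[K]_n) : K :=
  \sum_(S : {set 'I_n} | #|S| == k) principal_minor M S.

Definition delta_at (K : fieldType) (n : nat) (k : nat) (i : 'I_n)
    (M : 'M[K]_n) : K :=
  \sum_(S : {set 'I_n} | (#|S| == k) && (i \in S)) principal_minor M S.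

Definition replace_col (K : fieldType) (n : nat) (i : 'I_n) (B : 'M[K]_n)
    (w : 'cV[K]_n) : 'M[K]_n :=
  \matrix_(r, c) (if c == i then w r 0 else B r c).

Definition delta_repl (K : fieldType) (n : nat) (k : nat) (i : 'I_n)
    (B : 'M[K]_n) (w : 'cV[K]_n) : K :=
  delta_at k i (replace_col i B w).

(* Main.v *)
Require Import Defs.
From mathcomp Require Import all_boot all_order all_algebra.

Set Implicit Arguments.
Unset Strict Implicit.
Unset Printing Implicit Defensive.

Import GRing.Theory.
Local Open Scope ring_scope.

(** The identity is a coefficient of Cramer's rule for the polynomial matrix
    N = 1 + 'X B.

    Determinants are additive in each column, so \det N is a sum over the set S
    of columns where the 'X part is chosen ([det_add_cols]); the other columns
    are unit vectors, and the term of S is 'X^#|S| times the principal minor of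
    B on S ([det_cols_outside1]).  Hence \det N = \sum_k delta k B * 'X^k.  If
    column i of N is replaced by 'X w, there is no unit vector to choose in that
    column, so only the sets S containing i survive, and the determinant becomes
    \sum_k delta_repl k i B w * 'X^k.  By Laplace expansion
    ([det_replaced_col]) it is also 'X times the i-th entry of \adj N *m w
    ([coef_adj_delta_repl]), which is linear in w.

    The left hand side of the theorem is therefore the coefficient of 'X^k in
    the i-th entry of
    \adj N *m ('X B v + v) = \adj N *m N *m v = \det N * v,
    that is, delta k B * v i. *)

Section CommutativeRing.

Variable R : comNzRingType.

(** Both sides are the determinant of the block matrix with rows (1, - A) and
    (C, 1), computed by eliminating either off-diagonal block. *)
Lemma det_add1_mulmxC m n (A : 'M[R]_(m, n)) (C : 'M[R]_(n, m)) :
  \det (1%:M + A *m C) = \det (1%:M + C *m A).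
Proof.
pose T := block_mx 1%:M (- A) C 1%:M.
have -> : \det (1%:M + A *m C) = \det T.
  transitivity (\det (T *m block_mx 1%:M 0 (- C) 1%:M)); last first.
    by rewrite det_mulmx det_lblock !det1 !mulr1.
  rewrite mulmx_block !mulmx1 !mulmx0 !mul1mx add0r mulmxN mulNmx opprK.
  by rewrite subrr add0r det_ublock det1 mulr1.
transitivity (\det (block_mx 1%:M 0 (- C) 1%:M *m T)).
  by rewrite det_mulmx det_lblock !det1 !mul1r.
rewrite mulmx_block !mul1mx !mul0mx !addr0 mulmx1 addNr mulmxN mulNmx opprK.
by rewrite det_ublock det1 mul1r addrC.
Qed.

Lemma det_add_cols n (A C : 'M[R]_n) :
  \det (A + C)
  = \sum_(S : {set 'I_n})
      \det (\matrix_(r, c) if c \in S then A r c else C r c).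
Proof.
rewrite -det_tr /determinant.
under eq_bigr => s _.
  under eq_bigr => c _ do rewrite !mxE.
  rewrite bigA_distr mulr_sumr; over.
rewrite exchange_big /=; apply: eq_bigr => S _.
rewrite -[RHS]det_tr; apply: eq_bigr => s _; congr (_ * _).
by apply: eq_bigr => c _; rewrite !mxE.
Qed.

(** With P the n x #|S| matrix of the inclusion of S, the matrix on the left is
    1 + ((M - 1) P) P^T; exchanging the two factors gives
    1 + P^T (M - 1) P = P^T M P, since P^T P = 1. *)
Lemma det_cols_outside1 n (M : 'M[R]_n) (S : {set 'I_n}) :
  \det (\matrix_(r, c) if c \in S then M r c else (1%:M : 'M[R]_n) r c)
  = \det (mxsub (@enum_val _ (mem S)) (@enum_val _ (mem S)) M).
Proof.
set f := @enum_val _ _.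
have -> : \matrix_(r, c) (if c \in S then M r c else 1%:M r c)
    = 1%:M + colsub f (M - 1%:M) *m rowsub f 1%:M.
  apply/matrixP=> r c; rewrite !mxE.
  under eq_bigr => a _ do rewrite !mxE.
  rewrite -(big_enum_val (fun s => (M r s - (r == s)%:R) * (s == c)%:R)) /=.
  case: ifPn => [cS | cNS].
    rewrite (bigD1 c) //= eqxx mulr1 big1 ?addr0 1?addrC ?subrK // => s.
    by case/andP=> _ /negPf ->; rewrite mulr0.
  rewrite big1 ?addr0 // => s sS.
  by have /negPf -> : s != c by [apply: contraNneq cNS => <-]; rewrite mulr0.
rewrite det_add1_mulmxC mul_rowsub_mx mul1mx; congr (\det _).
apply/matrixP=> a b; rewrite !mxE (inj_eq enum_val_inj).
by rewrite addrC subrK.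
Qed.

(** Laplace expansion along column i, whose cofactors do not see column i. *)
Lemma det_replaced_col n (M : 'M[R]_n) (w : 'cV[R]_n) (i : 'I_n) :
  \det (\matrix_(r, c) if c == i then w r 0 else M r c) = (\adj M *m w) i 0.
Proof.
rewrite (expand_det_col _ i) mxE; apply: eq_bigr => r _.
rewrite !mxE eqxx mulrC; congr (_ * _ * _); congr (\det _).
apply/matrixP=> a b; rewrite !mxE.
by rewrite eq_sym (negPf (neq_lift _ _)).
Qed.

End CommutativeRing.

Section PrincipalMinorSums.

Variables (K : fieldType) (n : nat).
Implicit Types (B M : 'M[K]_n) (w : 'cV[K]_n).

Local Notation polymx M := (map_mx polyC M).

Lemma det_cols_outside1_polyX M (S : {set 'I_n}) :
  \det (\matrix_(r, c) if c \in S then ('X *: polymx M) r c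
                        else (1%:M : 'M[{poly K}]_n) r c)
  = principal_minor M S *: 'X^#|S|.
Proof.
rewrite det_cols_outside1 /principal_minor.
set f := @enum_val _ _.
have -> : mxsub f f ('X *: polymx M) = 'X *: polymx (mxsub f f M).
  by apply/matrixP=> a b; rewrite !mxE.
by rewrite detZ det_map_mx -mul_polyC mulrC.
Qed.

Lemma coef_det_delta k M : (\det (1%:M + 'X *: polymx M))`_k = delta k M.
Proof.
rewrite addrC det_add_cols coef_sum [in RHS]/delta [RHS]big_mkcond.
apply: eq_bigr => S _; rewrite det_cols_outside1_polyX coefZ coefXn eq_sym.
by case: ifP => _; rewrite ?mulr1 ?mulr0.
Qed.

(** Once column i is replaced by 'X w it has no constant part, so in the
    expansion over column choices S every term with i outside S has a zero
    column. *)
Lemma coef_adj_delta_repl k (i : 'I_n) B w :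
  ('X * (\adj (1%:M + 'X *: polymx B) *m polymx w) i 0)`_k = delta_repl k i B w.
Proof.
set N := 1%:M + _.
have <- : \det (\matrix_(r, c) if c == i then ('X *: polymx w) r 0 else N r c)
    = 'X * (\adj N *m polymx w) i 0.
  by rewrite det_replaced_col -scalemxAr mxE.
pose D : 'M[{poly K}]_n := \matrix_(r, c) if c == i then 0 else (r == c)%:R.
have -> : \matrix_(r, c) (if c == i then ('X *: polymx w) r 0 else N r c)
    = 'X *: polymx (replace_col i B w) + D.
  apply/matrixP=> r c; rewrite !mxE.
  by case: ifP => _; rewrite ?addr0 // addrC.
rewrite det_add_cols coef_sum /delta_repl [RHS]big_mkcond.
apply: eq_bigr => S _.
have [iS | iNS] := boolP (i \in S); last first.
  rewrite andbF (expand_det_col _ i) big1 ?coef0 // => r _.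
  by rewrite !mxE (negPf iNS) eqxx mul0r.
rewrite andbT.
have -> : \matrix_(r, c) (if c \in S then ('X *: polymx (replace_col i B w)) r c
                          else D r c)
    = \matrix_(r, c) (if c \in S then ('X *: polymx (replace_col i B w)) r c
                      else (1%:M : 'M[{poly K}]_n) r c).
  apply/matrixP=> r c; rewrite !mxE; case: ifPn => // cNS.
  by have /negPf -> : c != i by [apply: contraNneq cNS => ->].
rewrite det_cols_outside1_polyX coefZ coefXn eq_sym.
by case: ifP => _; rewrite ?mulr1 ?mulr0.
Qed.

End PrincipalMinorSums.

Theorem theorem3p1 (K : fieldType) (n : nat) (B : 'M[K]_n) (v : 'cV[K]_n) :
  forall (i : 'I_n) (k : nat), (1 <= k)%N -> (k < n)%N ->
    delta_repl k i B (\col_(r < n) \sum_(j < n) B r j * v j 0)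
      + delta_repl k.+1 i B v
    = delta k B * v i 0.
Proof.
move=> i k _ _.
have -> : \col_(r < n) \sum_(j < n) B r j * v j 0 = B *m v.
  by apply/matrixP=> r c; rewrite ord1 !mxE.
rewrite -!coef_adj_delta_repl -coef_det_delta.
set N := 1%:M + _.
have -> : ('X * (\adj N *m map_mx polyC v) i 0)`_k.+1
    = ((\adj N *m map_mx polyC v) i 0)`_k by rewrite coefXM.
rewrite -coefMC -coefD; congr (nth 0 (polyseq _) k).
have -> : 'X * (\adj N *m map_mx polyC (B *m v)) i 0
    = (\adj N *m ('X *: map_mx polyC B *m map_mx polyC v)) i 0.
  by rewrite map_mxM -scalemxAl -scalemxAr [RHS]mxE.
have -> : (\det N * (v i 0)%:P) = (\adj N *m (N *m map_mx polyC v)) i 0.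
  by rewrite mulmxA mul_adj_mx mul_scalar_mx !mxE.
by rewrite [in RHS]mulmxDl mul1mx mulmxDr [RHS]mxE addrC.
Qed.
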